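(* For every $c_0 > 0$ there exists an integer $r_0 = r_0(c_0)$ such that the following holds. For every integer $r \ge r_0$ and every integer $k \ge 3$ there exists $n_0 = n_0(r,k,c_0)$ such that every linear $r$-uniform hypergraph on $n \ge n_0$ vertices with linear density at least $c_0$ contains an $((r-2)k+3,\, k)$-configuration.
   Context: An $r$-uniform hypergraph $H$ consists of a finite vertex set $V(H)$ and a set $E(H)$ of (distinct) $r$-element subsets of $V(H)$, called edges. It is linear if any two distinct edges intersect in at most one vertex. The linear density of a linear $r$-uniform hypergraph $H$ on $n$ vertices is the number $c$ defined by $|E(H)| = c\,\binom{n}{2}/\binom{r}{2}$ (uniformity $r \ge 3$ throughout). For integers $s > k \ge 2$, an $(s,k)$-configuration in $H$ is a collection of $k$ distinct edges of $H$ whose union has at most $s$ vertices. *)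

(* Defs.v *)
From mathcomp Require Import all_boot all_order all_algebra.
From mathcomp Require Import reals.

Set Implicit Arguments.
Unset Strict Implicit.
Unset Printing Implicit Defensive.

Import Order.TTheory GRing.Theory Num.Theory.

(* A hypergraph is given by its vertex set, the finite type V, and its edge
   set E : {set {set V}}. *)

Definition uniform (V : finType) (r : nat) (E : {set {set V}}) : Prop :=
  forall e : {set V}, e \in E -> #|e| = r.

Definition linear_hypergraph (V : finType) (E : {set {set V}}) : Prop :=
  forall e f : {set V}, e \in E -> f \in E -> e != f -> #|e :&: f| <= 1.

(* The number c such that #|E| = c * 'C(#|V|, 2) / 'C(r, 2). It is meaningful
   for 2 <= #|V| and 2 <= r; otherwise it is 0, as x / 0 = 0. *)
Definition linear_density (R : realType) (V : finType) (r : nat)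
    (E : {set {set V}}) : R :=
  (#|E|%:R / ('C(#|V|, 2)%:R / 'C(r, 2)%:R))%R.

Definition configuration (V : finType) (s k : nat)
    (E S : {set {set V}}) : Prop :=
  [/\ S \subset E, #|S| = k & #|cover S| <= s].

(* Main.v *)
Require Import Defs.
From mathcomp Require Import all_boot all_order all_algebra.
From mathcomp Require Import reals.
From mathcomp Require Import zify.

Set Implicit Arguments.
Unset Strict Implicit.
Unset Printing Implicit Defensive.

Import Order.TTheory GRing.Theory Num.Theory.

(** Measure a set C of edges by its excess (r - 2) * #|C| - #|cover C|.  Two
    meeting edges have excess -3, and an edge that meets the union of C in at
    least two vertices can be added without lowering the excess.  So one wants
    to grow C from two meeting edges, always through such edges; if this never
    gets stuck before k edges, the result is the required configuration.

    The growth is steered by triangles, that is, triples of pairwise meeting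
    edges without a common vertex: when two edges of a triangle lie in C, the
    third one meets the union of C in two distinct vertices.  Two successive
    convexity estimates (the degrees of the vertices, then the number of edges
    that join a vertex to a given edge) show that a pair of meeting edges lies
    on average in a number of triangles of order c0 * r ^ 2, hence in more than
    a prescribed multiple of r once r is large in terms of c0 alone
    (many_triangles).  Discarding repeatedly the pairs that lie in few of the
    surviving triangles leaves a nonempty core W, in which each pair of edges of
    a triangle lies in at least 4 * r triangles of W (dense_core,
    triangle_core).

    Grow C along the triangles of W, and suppose it gets stuck.  Then every edge
    h of C is in a pair {h, f} of a triangle of W, all triangles of W on this
    pair are inside C, and there are at least 4 * r of them; as a triangle on
    {h, f} is determined by its vertices on h and on f, at least four vertices
    of h lie on a second edge of C (core_edge_double_points).  Summing degrees
    over C, this forces #|cover C| <= (r - 2) * #|C|, i.e., the excess is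
    nonnegative (cover_of_double_points).

    A stuck set is therefore harmless: put it aside, delete its edges, and start
    again in the remaining hypergraph, whose density has hardly changed since
    fewer than k edges are deleted in all.  Excess is superadditive, so the sets
    put aside have nonnegative total excess, and the last, unfinished one brings
    it down to -3 at worst (configuration_of_local_alternative). *)

(** * Two counting principles *)

Lemma double_count (S T : finType) (R : S -> T -> bool)
    (A : {set S}) (B : {set T}) :
  \sum_(x in A) #|[set y in B | R x y]| = \sum_(y in B) #|[set x in A | R x y]|.
Proof.
have cardE (U : finType) (D : {set U}) (P : pred U) :
    #|[set y in D | P y]| = \sum_(y in D) P y.
  rewrite -sum1_card (eq_bigl (fun y => (y \in D) && P y)); last first.
    by move=> y; rewrite inE.
  by rewrite big_mkcondr; apply: eq_bigr => y _; case: (P y).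
under eq_bigr do rewrite cardE.
by rewrite exchange_big; apply: eq_bigr => y _; rewrite cardE.
Qed.

(** Delete greedily each item i that is incident to fewer than d surviving
    elements of W, together with these elements.  A deleted item is paid for by
    fewer than d elements, so #|W| > d * #|A| keeps W from being exhausted. *)
Lemma dense_core (I T : finType) (inc : I -> T -> bool) (d : nat)
    (A : {set I}) (W : {set T}) :
  d * #|A| < #|W| ->
  exists W' : {set T}, [/\ W' \subset W, W' != set0 &
    forall i t, i \in A -> t \in W' -> inc i t ->
      d <= #|[set u in W' | inc i u]|].
Proof.
elim: {A}_.+1 {-2}A (ltnSn #|A|) W => // n IH A An W HW.
case: (boolP [exists i in A, #|[set u in W | inc i u]| < d]); last first.
  rewrite negb_exists_in => /forall_inP HA; exists W; split=> //.
    by rewrite -card_gt0; lia.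
  by move=> i t iA _ _; rewrite leqNgt HA.
case/exists_inP => i iA lt.
have cA := cardsD1 i A; rewrite iA in cA.
have cW := cardsID [set u in W | inc i u] W.
have cI : #|W :&: [set u in W | inc i u]| <= #|[set u in W | inc i u]|.
  by rewrite subset_leq_card // subsetIr.
have lt1 : #|A :\ i| < n by lia.
have lt2 : d * #|A :\ i| < #|W :\: [set u in W | inc i u]|.
  by move: HW; rewrite cA mulnDr muln1; lia.
have [W' [sub W'0 W'P]] := IH _ lt1 _ lt2.
exists W'; split=> //; first exact: subset_trans sub (subsetDl _ _).
move=> i' t i'A tW' it; have [ei|ni] := eqVneq i' i; last first.
  by apply: W'P tW' it; rewrite !inE ni.
have := subsetP sub t tW'; rewrite !inE -ei it andbT.
by case: (t \in W).
Qed.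

(** * Triangles *)

Lemma linear_eq (V : finType) (E : {set {set V}}) (e f : {set V}) (u v : V) :
  linear_hypergraph E -> e \in E -> f \in E -> u != v ->
  u \in e -> u \in f -> v \in e -> v \in f -> e = f.
Proof.
move=> linE eE fE uv ue uf ve vf; apply/eqP; apply: contraT => ef.
have := linE e f eE fE ef; rewrite leqNgt => /negP[].
by apply/card_gt1P; exists u, v; rewrite !inE ue uf ve vf uv.
Qed.

Definition triangles (V : finType) (E : {set {set V}}) : {set {set {set V}}} :=
  [set z : {set {set V}} | [&& z \subset E, #|z| == 3,
     [forall e in z, forall f in z, e :&: f != set0]
     & \bigcap_(e in z) e == set0]].

(** The vertices where the third edge meets the first two are distinct, since a
    common one would lie on all three edges. *)
Lemma triangle_third (V : finType) (E : {set {set V}}) (z : {set {set V}})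
    (e f : {set V}) :
  z \in triangles E -> e \in z -> f \in z -> e != f ->
  exists g p q, [/\ z = [set e; f; g], g != e, g != f, p != q &
    [/\ p \in g, p \in e, q \in g & q \in f]].
Proof.
rewrite inE => /and4P[_ /eqP z3 /forall_inP meet /eqP cap] ez fz ef.
have : 0 < #|z :\: [set e; f]|.
  rewrite cardsD subn_gt0 z3 ltnS (leq_trans (subset_leq_card (subsetIr _ _))) //.
  by rewrite cards2 ef.
case/card_gt0P => g; rewrite !inE negb_or => /andP[/andP[ge gf] gz].
have zE : z = [set e; f; g].
  apply/esym/eqP; rewrite eqEcard; apply/andP; split.
    by apply/subsetP => x; rewrite !inE => /orP[/orP[]|] /eqP->.
  rewrite z3 setUC cardsU1 cards2 ef !inE negb_or ge gf //.
have /forall_inP meetg := meet g gz.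
have /set0Pn[p /setIP[pg pe]] := meetg e ez.
have /set0Pn[q /setIP[qg qf]] := meetg f fz.
exists g, p, q; split=> //.
apply/eqP => pq; rewrite -{q}pq in qg qf.
have : p \in \bigcap_(e in z) e.
  by apply/bigcapP => x; rewrite zE !inE => /orP[/orP[]|] /eqP->.
by rewrite cap inE.
Qed.

(** * Growing a set of edges along a core of triangles *)

Lemma leq_cover_setU1 (V : finType) (C : {set {set V}}) (g : {set V}) :
  #|cover (g |: C)| + #|g :&: cover C| <= #|g| + #|cover C|.
Proof.
rewrite -(cardsUI g (cover C)) leq_add2r subset_leq_card //.
apply/bigcupsP => e; rewrite !inE => /orP[/eqP->|eC]; first exact: subsetUl.
by rewrite subsetU // bigcup_sup ?orbT.
Qed.

Definition degree (V : finType) (E : {set {set V}}) (v : V) : nat :=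
  #|[set e in E | v \in e]|.

(** A triangle on the pair {h, f} is determined by the two points where its third
    edge meets h and f.  All these triangles lie in C, so the point on h has
    degree at least 2 in C, and the point on f is one of r: at least 4 * r
    triangles need at least 4 such points on h. *)
Lemma core_edge_double_points (V : finType) (r : nat) (E : {set {set V}})
    (W : {set {set {set V}}}) (C : {set {set V}}) (h f : {set V}) :
  0 < r -> uniform r E -> linear_hypergraph E -> W \subset triangles E ->
  C \subset E -> (forall z, z \in W -> 1 < #|z :&: C| -> z \subset C) ->
  h \in C -> f \in C -> h != f ->
  4 * r <= #|[set z in W | [set h; f] \subset z]| ->
  4 <= #|[set v in h | 1 < degree C v]|.
Proof.
move=> r0 uE lE WT CE closed hC fC hf many.
set Q := [set v in h | _].
have hE := subsetP CE h hC; have fE := subsetP CE f fC.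
(* The edge through the two points w.1 and w.2; set0 is a dummy value. *)
pose ed (w : V * V) := odflt set0 [pick g in E | (w.1 \in g) && (w.2 \in g)].
suff sub : [set z in W | [set h; f] \subset z]
    \subset [set [set h; f; ed w] | w in setX Q f].
  have := leq_trans many (leq_trans (subset_leq_card sub) (leq_imset_card _ _)).
  by rewrite cardsX (uE f fE) leq_pmul2r.
apply/subsetP => z; rewrite inE => /andP[zW hfz].
have zT := subsetP WT z zW.
have hz : h \in z by rewrite (subsetP hfz) // !inE eqxx.
have fz : f \in z by rewrite (subsetP hfz) // !inE eqxx orbT.
have [g [p [q [zE gh gf pq [pg ph qg qf]]]]] := triangle_third zT hz fz hf.
have zC : z \subset C.
  apply: closed => //; apply/card_gt1P; exists h, f.
  by rewrite !inE hz fz hC fC hf.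
have gC : g \in C by rewrite (subsetP zC) // zE !inE eqxx orbT.
have gE := subsetP CE g gC.
apply/imsetP; exists (p, q).
  rewrite !inE /= ph qf andbT; apply/card_gt1P; exists g, h.
  by rewrite !inE gC hC pg ph gh.
rewrite zE; congr (_ :|: [set _]); rewrite /ed.
case: pickP => [g' /and3P[g'E pg' qg'] | /(_ g)] /=; last by rewrite gE pg qg.
exact: (linear_eq lE gE g'E pq).
Qed.

Lemma sum_degrees (V : finType) (r : nat) (C : {set {set V}}) :
  uniform r C -> \sum_v degree C v = r * #|C|.
Proof.
move=> uC.
rewrite (eq_bigl [in [set: V]]); last by move=> v; rewrite inE.
rewrite (double_count (fun v (e : {set V}) => v \in e)).
rewrite (eq_bigr (fun=> r)); first by rewrite sum_nat_const mulnC.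
by move=> e eC; rewrite -(uC e eC); apply: eq_card => v; rewrite !inE.
Qed.

(** The points of degree at least 2 have degrees adding up to at least 4 * #|C|,
    and such a degree d exceeds 1 by at least d / 2.  Hence the sum r * #|C| of
    all degrees exceeds the number of covered points by at least 2 * #|C|. *)
Lemma cover_of_double_points (V : finType) (r : nat) (C : {set {set V}}) :
  1 < r -> uniform r C ->
  (forall h, h \in C -> 4 <= #|[set v in h | 1 < degree C v]|) ->
  #|cover C| <= (r - 2) * #|C|.
Proof.
move=> r1 uC H4.
have doubles : 4 * #|C| <= \sum_(v | 1 < degree C v) degree C v.
  rewrite (eq_bigl [in [set v | 1 < degree C v]]); last first.
    by move=> v; rewrite inE.
  rewrite (double_count (fun v (e : {set V}) => v \in e)) mulnC -sum_nat_const.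
  apply: leq_sum => h hC; apply: leq_trans (H4 h hC) _.
  by apply: subset_leq_card; apply/subsetP => v; rewrite !inE andbC.
have key : 2 * #|cover C| + \sum_(v | 1 < degree C v) degree C v
    <= 2 * \sum_v degree C v.
  rewrite -sum1_card !big_distrr [in X in X + _]big_mkcond.
  rewrite [X in _ + X]big_mkcond -big_split.
  apply: leq_sum => v _ /=.
  have : v \in cover C -> 0 < degree C v.
    by case/bigcupP => e eC ve; apply/card_gt0P; exists e; rewrite inE eC.
  by case: (v \in cover C) => [/(_ isT)|_]; case: ifP; lia.
move: (leq_trans (leq_add (leqnn _) doubles) key).
rewrite (sum_degrees uC) mulnBl; lia.
Qed.

(** Either the growth reaches j edges, or it is stuck earlier at a set of
    nonnegative excess.  The first alternative is needed for every j, because the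
    last round of growth has to stop at the exact number of missing edges. *)
Lemma core_gives_configurations (V : finType) (r : nat) (E : {set {set V}})
    (W : {set {set {set V}}}) (j : nat) :
  1 < r -> uniform r E -> linear_hypergraph E ->
  W \subset triangles E -> W != set0 ->
  (forall e f z, z \in W -> e \in z -> f \in z -> e != f ->
     4 * r <= #|[set u in W | [set e; f] \subset u]|) ->
  0 < j ->
  exists C : {set {set V}}, C \subset E /\
    ((#|C| = j /\ #|cover C| <= (r - 2) * j + 3) \/
     (0 < #|C| < j /\ #|cover C| <= (r - 2) * #|C|)).
Proof.
move=> r1 uE lE WT /set0Pn[z0 z0W] core j0.
have subE z : z \in W -> z \subset E.
  by move=> /(subsetP WT); rewrite inE => /and4P[].
have : 1 < #|z0|.
  by have := subsetP WT _ z0W; rewrite inE => /and4P[_ /eqP->].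
case/card_gt1P => e0 [f0 [e0z f0z e0f0]].
have e0E := subsetP (subE _ z0W) _ e0z.
have f0E := subsetP (subE _ z0W) _ f0z.
have [j1|j2] := leqP j 1.
  exists [set e0]; split; first by rewrite sub1set.
  by left; rewrite cards1 /cover big_set1 (uE _ e0E) (_ : j = 1); [split|]; lia.
(* Each edge of C must belong to a core triangle having a second edge in C: this
   is what gives every edge its double points once the growth is stuck. *)
suff [C [CE [[cC covC _]|]]] : exists C : {set {set V}}, C \subset E /\
   ([/\ #|C| = j, #|cover C| <= (r - 2) * j + 3 &
     forall h, h \in C -> exists f z,
       [/\ z \in W, f \in C, h \in z, f \in z & h != f]] \/
    (0 < #|C| < j /\ #|cover C| <= (r - 2) * #|C|)).
- by exists C; split=> //; left.
- by exists C; split=> //; right.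
elim: j {j0} j2 => // j IH; rewrite ltnS leq_eqVlt => /orP[/eqP<-|j1].
  exists [set e0; f0]; split.
    by apply/subsetP => x; rewrite !inE => /orP[] /eqP->.
  left; rewrite cards2 e0f0; split=> //.
    have /forall_inP/(_ e0 e0z)/forall_inP/(_ f0 f0z) :
        [forall e in z0, forall f in z0, e :&: f != set0].
      by have := subsetP WT _ z0W; rewrite inE => /and4P[].
    rewrite -card_gt0 /cover big_setU1 ?inE //= big_set1.
    by have := cardsUI e0 f0; rewrite (uE _ e0E) (uE _ f0E); lia.
  move=> h; rewrite !inE => /orP[] /eqP->.
    by exists f0, z0; rewrite set22.
  by exists e0, z0; rewrite set21 eq_sym.
have [C [CE [[cC covC pairs]|[/andP[C0 Cj] covC]]]] := IH j1; last first.
  by exists C; split=> //; right; rewrite C0 ltnW.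
case: (boolP [exists z in W, (1 < #|z :&: C|) && ~~ (z \subset C)]); last first.
  rewrite negb_exists_in => /forall_inP closed.
  exists C; split=> //; right; rewrite cC ltnSn ltnW // -cC; split=> //.
  apply: cover_of_double_points => // [e /(subsetP CE)/uE //|h hC].
  have [f [z [zW fC hz fz hf]]] := pairs h hC.
  apply: (core_edge_double_points (f := f) _ uE lE WT) => //.
  - exact: ltnW.
  - by move=> u uW u2; move: (closed u uW); rewrite u2 negbK.
  - exact: core zW _ _ hf.
case/exists_inP => z zW /andP[/card_gt1P[e [f [/setIP[ez eC] /setIP[fz fC] ef]]]].
have zT := subsetP WT _ zW.
have [g [p [q [zE ge gf pq [pg pe qg qf]]]]] := triangle_third zT ez fz ef.
rewrite zE => /subsetPn[x]; rewrite !inE -orbA => /or3P[] /eqP->; rewrite ?eC ?fC //.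
move=> gC; exists (g |: C).
have gz : g \in z by rewrite zE !inE eqxx orbT.
have gE : g \in E by rewrite (subsetP (subE _ zW)).
split; first by rewrite subUset sub1set gE.
left; rewrite cardsU1 gC cC; split=> //.
  have : 1 < #|g :&: cover C|.
    apply/card_gt1P; exists p, q; rewrite !inE pg qg pq; split=> //.
      by apply/bigcupP; exists e.
    by apply/bigcupP; exists f.
  have := leq_cover_setU1 C g; rewrite (uE _ gE) mulnS.
  by clear -r1 covC; lia.
move=> h; rewrite !inE => /orP[/eqP->|hC].
  by exists e, z; rewrite !inE eC orbT.
have [f' [z' [z'W f'C hz' fz' hf']]] := pairs h hC.
by exists f', z'; rewrite !inE f'C orbT.
Qed.

(** * Counting triangles *)

(** Convexity of d * (d - 1), in integers: (d - a) * (d - a - 1) >= 0.  Summed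
    over d, with a just below the mean, it plays the part of the Cauchy-Schwarz
    inequality. *)
Lemma tangent_bound (a d : nat) : 2 * a * d <= d * (d - 1) + a * (a + 1).
Proof.
have [da|ad] := leqP d a.
  by rewrite -(subnK da); move: (a - d) => x; case: d {da} => [|d]; nia.
by rewrite -(subnK ad); move: (d - a.+1) => x; rewrite addnS subn1 /=; nia.
Qed.

Definition neighbours (V : finType) (E : {set {set V}}) (g : {set V}) :
    {set {set V}} :=
  [set f in E | (f != g) && (f :&: g != set0)].

Definition crossing (V : finType) (E : {set {set V}}) (v : V) (g : {set V}) :
    {set {set V}} :=
  [set e in E | (v \in e) && (e :&: g != set0)].

(** Both sides count ordered pairs of distinct meeting edges, on the left by their
    common vertex. *)
Lemma sum_neighbours_ge (V : finType) (E : {set {set V}}) :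
  linear_hypergraph E ->
  \sum_v degree E v * (degree E v - 1) <= \sum_(g in E) #|neighbours E g|.
Proof.
move=> lE.
have -> : \sum_v degree E v * (degree E v - 1) =
    \sum_(g in E) \sum_(v in g) #|[set f in E :\ g | v \in f]|.
  rewrite (exchange_big_dep predT) //=; apply: eq_bigr => v _.
  rewrite /degree.
  rewrite (eq_bigl [in [set e in E | v \in e]]); last by move=> e; rewrite !inE.
  rewrite -sum_nat_const; apply: eq_bigr => g; rewrite inE => /andP[gE vg].
  rewrite [in LHS](cardsD1 g) inE gE vg add1n subn1 /=; apply: eq_card => f.
  by rewrite !inE andbA.
apply: leq_sum => g gE; rewrite (double_count (fun v (f : {set V}) => v \in f)).
rewrite /neighbours -sum1_card.
rewrite [leqRHS](eq_bigl (fun f => (f \in E :\ g) && (f :&: g != set0))).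
  rewrite big_mkcondr; apply: leq_sum => f; rewrite !inE => /andP[fg fE].
  have -> : [set v in g | v \in f] = f :&: g by apply/setP=> v; rewrite !inE andbC.
  have [->|_] := eqVneq (f :&: g) set0; first by rewrite cards0.
  exact: lE.
by move=> f; rewrite !inE andbA (andbC (f \in E)).
Qed.

(** If e is another edge meeting g, each of the r - 1 vertices of e outside g is
    joined to g by e. *)
Lemma sum_crossing_ge (V : finType) (r : nat) (E : {set {set V}}) :
  uniform r E -> linear_hypergraph E ->
  (r - 1) * \sum_(g in E) #|neighbours E g|
    <= \sum_(g in E) \sum_(v in ~: g) #|crossing E v g|.
Proof.
move=> uE lE; rewrite big_distrr; apply: leq_sum => g gE /=.
rewrite (double_count (fun v (e : {set V}) => (v \in e) && (e :&: g != set0))).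
rewrite mulnC -sum_nat_const.
rewrite (eq_bigl (fun e => (e \in E) && ((e != g) && (e :&: g != set0)))).
  rewrite big_mkcondr; apply: leq_sum => e eE.
  case: ifP => // /andP[eg meet].
  apply: (@leq_trans #|e :\: g|); first by rewrite cardsD (uE e eE) leq_sub // lE.
  apply: subset_leq_card; apply/subsetP => v; rewrite !inE => /andP[-> ->].
  by rewrite meet.
by move=> e; rewrite inE.
Qed.

Lemma crossing_triangle (V : finType) (E : {set {set V}}) (v : V)
    (g e f : {set V}) :
  linear_hypergraph E -> g \in E -> v \notin g ->
  e \in crossing E v g -> f \in crossing E v g -> e != f ->
  [set g; e; f] \in triangles E.
Proof.
move=> lE gE vg; rewrite !inE => /and3P[eE ve eg] /and3P[fE vf fg] ef.
have neq (x : {set V}) : v \in x -> g != x by apply: contraTneq => <-.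
have g0 : g != set0 by apply: contraNneq eg => ->; rewrite setI0.
have sE x : x \in [set g; e; f] -> [\/ x = g, x = e | x = f].
  by rewrite !inE -orbA => /or3P[] /eqP->; [constructor 1|constructor 2|constructor 3].
apply/and4P; split.
- by apply/subsetP => x /sE[] ->.
- by rewrite setUC cardsU1 cards2 !inE negb_or (neq e) // !(eq_sym f) neq // ef.
- have efm : e :&: f != set0 by apply/set0Pn; exists v; rewrite inE ve.
  have e0 : e != set0 by apply/set0Pn; exists v.
  have f0 : f != set0 by apply/set0Pn; exists v.
  apply/forall_inP => x /sE[] ->; apply/forall_inP => y /sE[] ->;
    by rewrite ?setIid // setIC.
- apply/eqP/setP => p; rewrite inE; apply/negbTE/negP => /bigcapP pz.
  have [pg pe pf] : [/\ p \in g, p \in e & p \in f].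
    by split; apply: pz; rewrite !inE eqxx ?orbT.
  have vp : v != p by apply: contraNneq vg => ->.
  by case/eqP: ef; apply: linear_eq lE eE fE vp ve vf pe pf.
Qed.

(** Two edges through v that both meet g form a triangle with g.  Since v is the
    only common vertex of these two edges, a triangle z arises at most once from
    each ordered triple of its members, hence at most 3 ^ 3 = 27 times. *)
Lemma sum_crossing_pairs_le (V : finType) (E : {set {set V}}) :
  linear_hypergraph E ->
  \sum_(g in E) \sum_(v in ~: g) #|crossing E v g| * (#|crossing E v g| - 1)
    <= 27 * #|triangles E|.
Proof.
move=> lE.
pose T := {set V}.
pose Q := [set q : (T * V) * (T * T) | [&& q.1.1 \in E, q.1.2 \notin q.1.1,
  q.2.1 \in crossing E q.1.2 q.1.1, q.2.2 \in crossing E q.1.2 q.1.1 &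
  q.2.1 != q.2.2]].
pose tri (q : (T * V) * (T * T)) : {set T} := [set q.1.1; q.2.1; q.2.2].
apply: (@leq_trans #|Q|).
  rewrite pair_big_dep /= -[leqRHS]sum1_card.
  rewrite (partition_big (fun q : (T * V) * (T * T) => q.1)
    (fun gv : T * V => (gv.1 \in E) && (gv.2 \in ~: gv.1))) /=; last first.
    by move=> q; rewrite !inE => /and5P[-> ->].
  apply: leq_sum => -[g v] /= /andP[gE]; rewrite inE => vg.
  set D := crossing E v g.
  pose D2 := [set p : T * T | [&& p.1 \in D, p.2 \in D & p.1 != p.2]].
  have -> : #|D| * (#|D| - 1) = #|D2|.
    rewrite -[RHS]sum1_card (partition_big (fun p : T * T => p.1) [in D]) /=; last first.
      by move=> p; rewrite inE => /and3P[].
    rewrite -sum_nat_const; apply: eq_bigr => e eD.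
    rewrite [in LHS](cardsD1 e) eD add1n subn1 /=.
    have inj : injective (fun f : T => (e, f)) by move=> x y [].
    rewrite -(card_imset _ inj) -sum1_card; apply: eq_bigl => -[x y] /=.
    rewrite !inE /=; apply/imsetP/idP.
      case=> f; rewrite !inE => /andP[fe /andP[fE ff]] [-> ->].
      by move: eD; rewrite !inE fE ff eqxx (eq_sym e) fe => ->.
    case/andP => /and3P[xD yD xy] /eqP xe; exists y; last by rewrite xe.
    by move: yD; rewrite !inE -xe (eq_sym y) xy.
  have inj : injective (fun p : T * T => ((g, v), p)) by move=> x y [].
  rewrite -(card_imset _ inj) -[leqLHS]sum1_card.
  rewrite [leqRHS](eq_bigl [in [set (g, v, p) | p in D2]]) //.
  move=> [gv p] /=; rewrite inE /=; apply/idP/imsetP.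
    case/andP => /and5P[H1 H2 H3 H4 H5] /eqP E1.
    by exists p; rewrite ?E1 // inE; move: H3 H4; rewrite E1 /= => -> ->.
  case=> p'; rewrite inE => /and3P[H1 H2 H3] [-> ->] /=.
  by rewrite gE vg H1 H2 H3 eqxx.
rewrite -sum1_card (partition_big tri [in triangles E]) /=; last first.
  move=> [[g v] [e f]]; rewrite inE /= => /and5P[gE vg eD fD ef].
  exact: crossing_triangle lE gE vg eD fD ef.
rewrite mulnC -sum_nat_const; apply: leq_sum => z zT.
have z3 : #|z| = 3 by move: zT; rewrite inE => /and4P[_ /eqP].
have -> : 27 = #|setX z (setX z z)| by rewrite !cardsX z3.
pose drop (q : (T * V) * (T * T)) := (q.1.1, q.2).
rewrite (eq_bigl [in [set q in Q | tri q == z]]); last first.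
  by move=> q; rewrite !inE.
rewrite sum1_card -(card_in_imset (f := drop)).
  apply: subset_leq_card; apply/subsetP => _ /imsetP[q + ->].
  by rewrite inE => /andP[_ /eqP<-]; rewrite !inE /= !eqxx !orbT.
move=> [[g v] [e f]] [[g' v'] [e' f']]; rewrite !inE /=.
move=> /andP[/and5P[gE vg /and3P[eE ve _] /and3P[fE vf _] ef] _].
move=> /andP[/and5P[_ _ /and3P[_ ve' _] /and3P[_ vf' _] _] _] [<- ee ff].
rewrite -ee in ve' *; rewrite -ff in vf' *.
congr (_, _, _); apply/eqP; apply: contraNT ef => vv.
by apply/eqP; apply: linear_eq lE eE fE vv ve vf ve' vf'.
Qed.

(** The first hypothesis bounds the mean degree below by b + 1; then the mean
    number of edges joining a vertex to an edge is at least a + 1 by the second,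
    and an ordered pair of meeting edges extends on average to at least
    a * (r - 1) triangles, up to the overcounting by 27. *)
Lemma many_triangles (V : finType) (r a b : nat) (E : {set {set V}}) :
  uniform r E -> linear_hypergraph E ->
  b.+1 * #|V| <= r * #|E| -> a.+1 * #|V| <= (r - 1) * (b * r) ->
  b * (r * #|E|) <= \sum_(g in E) #|neighbours E g| /\
  a * ((r - 1) * \sum_(g in E) #|neighbours E g|) <= 27 * #|triangles E|.
Proof.
move=> uE lE hb ha.
have H1 := sum_neighbours_ge lE; have H2 := sum_crossing_ge uE lE.
have H3 := sum_crossing_pairs_le lE.
have pairs : b * (r * #|E|) <= \sum_(g in E) #|neighbours E g|.
  apply: leq_trans H1; rewrite -(leq_add2r (\sum_(v : V) b * (b + 1))).
  rewrite -big_split /=.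
  apply: (@leq_trans (\sum_v 2 * b * degree E v)); last first.
    by apply: leq_sum => v _; apply: tangent_bound.
  rewrite -[leqRHS]big_distrr /= (sum_degrees uE) sum_nat_const.
  by move: hb; clear; move: #|V| #|_| => n m; nia.
split=> //.
move: pairs H2 H3; set P := \sum_(g in E) _; set D := \sum_(g in E) \sum_(v in _) _.
move=> pairs H2 H3.
have dense : a.+1 * #|V| * #|E| <= D.
  apply: leq_trans H2; apply: leq_trans (leq_mul (leqnn _) pairs).
  by rewrite !mulnA leq_mul2r -!mulnA ha orbT.
have : 2 * a * D <= 27 * #|triangles E| + a * (a.+1 * #|V| * #|E|).
  apply: leq_trans (leq_add H3 (leqnn _)).
  apply: (@leq_trans (\sum_(g in E) \sum_(v in ~: g)
      (#|crossing E v g| * (#|crossing E v g| - 1) + a * (a + 1)))).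
    rewrite big_distrr; apply: leq_sum => g _; rewrite big_distrr /=.
    by apply: leq_sum => v _; apply: tangent_bound.
  under eq_bigr do rewrite big_split /=.
  rewrite big_split leq_add2l.
  apply: (@leq_trans (\sum_(g in E) #|V| * (a * (a + 1)))).
    by apply: leq_sum => g _; rewrite sum_nat_const leq_mul2r max_card orbT.
  by rewrite sum_nat_const addn1; apply: eq_leq; clear; nia.
have : a * ((r - 1) * P) <= a * D by rewrite leq_mul2l H2 orbT.
have : a * (a.+1 * #|V| * #|E|) <= a * D by rewrite leq_mul2l dense orbT.
by clear; rewrite -mulnA; lia.
Qed.

(** With 27-fold counting, 4 * r triangles for each pair require
    a * (r - 1) > 27 * 4 * r, which holds for a = 217 as soon as r >= 3; the
    constant 218 is a + 1. *)
Lemma triangle_core (V : finType) (r b : nat) (E : {set {set V}}) :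
  2 < r -> uniform r E -> linear_hypergraph E -> E != set0 -> 0 < b ->
  b.+1 * #|V| <= r * #|E| -> 218 * #|V| <= (r - 1) * (b * r) ->
  exists W : {set {set {set V}}}, [/\ W \subset triangles E, W != set0 &
    forall e f z, z \in W -> e \in z -> f \in z -> e != f ->
     4 * r <= #|[set u in W | [set e; f] \subset u]|].
Proof.
move=> r2 uE lE E0 b0 hb ha; have [P0 PT] := many_triangles uE lE hb ha.
pose A := \bigcup_(g in E) [set [set g; f] | f in neighbours E g].
have AP : #|A| <= \sum_(g in E) #|neighbours E g|.
  rewrite /A; elim/big_rec2: _ => [|g s B _ IH]; first by rewrite cards0.
  apply: leq_trans (leq_card_setU _ _) _.
  by rewrite leq_add // leq_imset_card.
have lt : 4 * r * #|A| < #|triangles E|.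
  have P1 : 0 < \sum_(g in E) #|neighbours E g|.
    by apply: leq_trans P0; rewrite !muln_gt0 b0 card_gt0 E0 andbT; lia.
  move: P1 PT AP; move: (\sum_(g in E) _) => P; move: #|A| #|triangles E|.
  by clear -r2 => x t P1 PT xP; nia.
have [W [WT W0 core]] := dense_core (fun (x z : {set {set V}}) => x \subset z) lt.
exists W; split=> // e f z zW ez fz ef; apply: (core _ z) => //.
  have := subsetP WT _ zW; rewrite inE => /and4P[zE _ /forall_inP meet _].
  have /forall_inP meete := meet f fz.
  apply/bigcupP; exists e; first exact: (subsetP zE).
  by apply: imset_f; rewrite inE (subsetP zE f fz) eq_sym ef meete.
by apply/subsetP => x; rewrite !inE => /orP[] /eqP->.
Qed.

(** * Assembling configurations of exactly k edges *)

(** Keep a set F of nonnegative excess.  If the growth outside F produces the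
    k - #|F| missing edges, the total excess is at least -3; if it gets stuck, F
    absorbs the stuck set and its excess remains nonnegative. *)
Lemma configuration_of_local_alternative (V : finType) (r k : nat)
    (E : {set {set V}}) :
  (forall (F : {set {set V}}) j, F \subset E -> #|F| < k -> 0 < j ->
     exists C : {set {set V}}, C \subset E :\: F /\
       ((#|C| = j /\ #|cover C| <= (r - 2) * j + 3) \/
        (0 < #|C| < j /\ #|cover C| <= (r - 2) * #|C|))) ->
  exists S, configuration ((r - 2) * k + 3) k E S.
Proof.
move=> alt.
suff main n : forall F : {set {set V}}, F \subset E -> #|F| + n = k ->
    #|cover F| <= (r - 2) * #|F| ->
    exists S, configuration ((r - 2) * k + 3) k E S.
  by apply: (main k set0); rewrite ?sub0set ?cards0 // /cover big_set0 cards0.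
elim/ltn_ind: n => n IH F FE Fk covF.
case: (posnP n) => [n0|n_gt0].
  exists F; move: Fk; rewrite n0 addn0 => Fk.
  by split=> //; rewrite -Fk (leq_trans covF) // leq_addr.
have [|C [CE C_alt]] := alt F n FE _ n_gt0; first by rewrite -Fk -ltn_subLR ?subnn.
have FCE : F :|: C \subset E by rewrite subUset FE (subset_trans CE (subsetDl _ _)).
have cFC : #|F :|: C| = #|F| + #|C|.
  rewrite cardsU (_ : F :&: C = set0) ?cards0 ?subn0 //.
  by apply/eqP; rewrite setI_eq0 disjoint_sym; move: CE; rewrite subsetD => /andP[].
have covFC : #|cover (F :|: C)| <= #|cover F| + #|cover C|.
  apply: leq_trans (leq_card_setU _ _); apply: subset_leq_card.
  by rewrite /cover bigcup_setU.
case: C_alt => [[Cn covC]|[/andP[C0 Cn] covC]].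
  exists (F :|: C); split; rewrite ?cFC ?Cn //.
  rewrite (leq_trans covFC) // (leq_trans (leq_add covF covC)) //.
  by rewrite addnA -mulnDr Fk.
apply: (IH (n - #|C|) _ (F :|: C)) => //.
- by rewrite -subn_gt0 subKn // ltnW.
- by rewrite cFC -addnA subnKC // ltnW.
- by rewrite cFC mulnDr (leq_trans covFC) // leq_add.
Qed.

(** * Choice of the parameters *)

(** Here m is the number of edges left after fewer than k deletions and 1 / N is a
    lower bound for the density.  The loss of k edges costs at most a factor 2,
    so that the mean degree r * m / n is at least n / (2 * N * (r - 1)).  Its
    integer part q satisfies q >= 6, and b = q - 1 works: 218 * n is less than
    436 * N * (r - 1) * (q + 1), and q + 1 <= 3 * (q - 1), whence 1308 = 3 * 436. *)
Lemma density_numerics (N r k n m : nat) :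
  0 < N -> 1308 * N <= r -> 4 * N * r * r * k + 12 * N * r + 4 <= n ->
  n * (n - 1) <= N * (r * (r - 1)) * (m + k) ->
  exists b, [/\ 0 < b, b.+1 * n <= r * m & 218 * n <= (r - 1) * (b * r)].
Proof.
case: r => [|r] N0 rN nN dense; first by move: rN; rewrite leqn0 muln_eq0; lia.
move: dense; rewrite !subSS !subn0 => dense.
have n4 : 4 <= n by apply: leq_trans nN; rewrite leq_addl.
have n0 : 0 < n by exact: ltnW (ltnW (ltnW n4)).
have n12 : 12 * N * r.+1 <= n.
  by apply: leq_trans nN; rewrite -addnA addnCA leq_addr.
have dense' : n * n <= 2 * N * r * (r.+1 * m).
  have nk : 4 * (N * (r.+1 * r) * k) <= n.
    apply: leq_trans nN; rewrite -addnA -!mulnA; apply: leq_trans (leq_addr _ _).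
    by rewrite !leq_mul2l leq_mul2r leqnSn !orbT.
  have n4n : 4 * n <= n * n by rewrite leq_mul2r n4 orbT.
  have nn : n <= n * n by rewrite leq_pmulr.
  have sq : n * (n - 1) = n * n - n by rewrite mulnBr muln1.
  rewrite sq mulnDr in dense.
  have -> : 2 * N * r * (r.+1 * m) = 2 * (N * (r.+1 * r) * m).
    by rewrite -!mulnA; congr (_ * (_ * _)); rewrite !mulnA (mulnC r).
  move: nk n4n nn dense; clear.
  by move: (N * _ * m) (N * _ * k) (n * n) => x y z; lia.
pose q := (r.+1 * m) %/ n.
have qM : q * n <= r.+1 * m by exact: leq_divM.
have Mq : r.+1 * m < q.+1 * n by exact: ltn_ceil.
have nq : n < 2 * N * r * q.+1.
  rewrite -(ltn_pmul2r n0) (leq_ltn_trans dense') // -[ltnRHS]mulnA ltn_pmul2l //.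
  by rewrite !muln_gt0 N0; move: rN N0; clear; lia.
have q5 : 5 < q.
  rewrite -ltnS -(ltn_pmul2l (_ : 0 < 2 * N * r)); last first.
    by rewrite !muln_gt0 N0; move: rN N0; clear; lia.
  apply: leq_ltn_trans nq; apply: leq_trans n12.
  by rewrite mulnS; move: (N) => x; clear; nia.
move: q q5 qM nq {Mq} => q q5 qM nq.
exists q.-1; rewrite prednK ?(leq_trans _ q5) //; split=> //.
  by move: q5; clear; lia.
apply: (@leq_trans (r * (q.+1 * (436 * N)))).
  have -> : r * (q.+1 * (436 * N)) = 218 * (2 * N * r * q.+1).
    by clear; lia.
  by rewrite leq_mul2l ltnW.
rewrite leq_mul2l; apply/orP; right.
apply: (@leq_trans (q.-1 * (1308 * N))); last by rewrite leq_mul2l rN orbT.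
rewrite !mulnA leq_mul2r; apply/orP; right.
by move: q5; clear; lia.
Qed.

Lemma density_nat (R : realType) (c : R) (V : finType) (r N : nat)
    (E : {set {set V}}) :
  1 < r -> 1 < #|V| -> (1 <= N%:R * c)%R -> (c <= linear_density R r E)%R ->
  #|V| * (#|V| - 1) <= N * (r * (r - 1)) * #|E|.
Proof.
move=> r1 V1 Nc dens.
have bin2n n : 'C(n, 2) * 2 = n * (n - 1).
  by have := bin_ffact n 2; rewrite ffactnSr ffactn1.
have V0 : (0 < 'C(#|V|, 2)%:R :> R)%R by rewrite ltr0n bin_gt0.
have r0 : (0 < 'C(r, 2)%:R :> R)%R by rewrite ltr0n bin_gt0.
rewrite -!bin2n mulnA mulnAC leq_pmul2r // -(ler_nat R) !natrM.
have : (1 <= N%:R * linear_density R r E)%R.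
  by apply: le_trans Nc _; rewrite ler_wpM2l.
by rewrite /linear_density invf_div !mulrA ler_pdivlMr // mul1r [X in (_ <= X)%R]mulrAC.
Qed.

Theorem corollary1p4 (R : realType) (c0 : R) (hc0 : (0 < c0)%R) :
  exists r0 : nat, forall r : nat, 3 <= r -> r0 <= r ->
  forall k : nat, 3 <= k ->
  exists n0 : nat, forall (V : finType) (E : {set {set V}}),
    n0 <= #|V| ->
    uniform r E -> linear_hypergraph E ->
    (c0 <= linear_density R r E)%R ->
    exists S : {set {set V}}, configuration ((r - 2) * k + 3) k E S.
Proof.
pose N := (Num.bound c0^-1).
have Nc : (1 <= N%:R * c0)%R.
  by rewrite -ler_pdivrMr // mul1r ltW // archi_boundP // invr_ge0 ltW.
have N0 : 0 < N.
  by rewrite lt0n; apply: contraTneq Nc => ->; rewrite mul0r ler10.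
exists (1308 * N) => r r3 rN k k3.
exists (4 * N * r * r * k + 12 * N * r + 4) => V E nV uE lE dens.
have r1 : 1 < r by exact: ltnW.
have V1 : 1 < #|V| by apply: leq_trans nV; rewrite addnC.
apply: configuration_of_local_alternative => F j FE Fk j0.
have sE : E :\: F \subset E by exact: subsetDl.
have uE' : uniform r (E :\: F) by move=> e /(subsetP sE)/uE.
have lE' : linear_hypergraph (E :\: F).
  by move=> e f /(subsetP sE) eE /(subsetP sE) fE; apply: lE.
have dense : #|V| * (#|V| - 1) <= N * (r * (r - 1)) * (#|E :\: F| + k).
  apply: leq_trans (density_nat r1 V1 Nc dens) _; rewrite leq_mul2l.
  by rewrite -(cardsID F E) addnC leq_add2l (leq_trans _ (ltnW Fk)) ?orbT //
    subset_leq_card // subsetIr.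
have [b [b0 hb ha]] := density_numerics N0 rN nV dense.
have E0 : E :\: F != set0.
  apply: contraTneq hb => ->; rewrite cards0 muln0 -ltnNge muln_gt0.
  exact: ltnW.
have [W [WT W0 core]] := triangle_core r3 uE' lE' E0 b0 hb ha.
exact: core_gives_configurations r1 uE' lE' WT W0 core j0.
Qed.
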